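(* Let $n\ge1$, let $h\in\mathbb{R}$ with $h\neq0$, let $K$ be a symmetric nonsingular real $n\times n$ matrix, let $W\colon\mathbb{R}^n\to\mathbb{R}$ be a (possibly nonhomogeneous) polynomial of degree $\le4$, and let $f=-K\nabla W$. Let $\widetilde W(x,z)=z^4W(x/z)$ be the degree-$4$ homogenization of $W$ on $\mathbb{R}^{n+1}$, and let $\widetilde V$ be the symmetric $4$-linear form on $\mathbb{R}^{n+1}$ with $\widetilde W(y)=\frac14\widetilde V(y,y,y,y)$. For $\varepsilon\neq0$ let $\widetilde K_\varepsilon=\begin{pmatrix}K&0\\0&\varepsilon\end{pmatrix}$ and, for $y_0=(x_0,z_0)$, $y_1=(x_1,z_1)\in\mathbb{R}^{n+1}$, let $\widetilde M_\varepsilon=I+h^2\widetilde K_\varepsilon\widetilde V(y_0,y_1,\cdot,\cdot)$ and $$F_\varepsilon(y_0,y_1)=(y_1-y_0)^\top\widetilde K_\varepsilon^{-1}\widetilde M_\varepsilon^{-1}(y_1-y_0)-\tfrac12\,y_0^\top\widetilde K_\varepsilon^{-1}\left(\widetilde M_\varepsilon^{-1}-I\right)y_1 .$$ Then, as $\varepsilon\to0$, $$F_\varepsilon(y_0,y_1)=\frac1\varepsilon(z_1-z_0)^2+F_0(y_0,y_1)+\mathcal{O}(\varepsilon)$$ for a rational function $F_0$ of $(y_0,y_1)$, and the function $(x_0,x_1)\mapsto F_0\big((x_0,1),(x_1,1)\big)=\lim_{\varepsilon\to0}F_\varepsilon\big((x_0,1),(x_1,1)\big)$ is a first integral of the map $(x_0,x_1)\mapsto(x_1,x_2)$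 on $\mathbb{R}^{2n}$ in which $x_2$ is determined by $$x_2-2x_1+x_0=h^2\,\mathrm{pol}_3f(x_0,x_1,x_2).$$
   Context: $\widetilde V(y_0,y_1,\cdot,\cdot)$ denotes the symmetric $(n+1)\times(n+1)$ matrix $S$ with $u^\top Sv=\widetilde V(y_0,y_1,u,v)$ for all $u,v\in\mathbb{R}^{n+1}$. Polarization: for a homogeneous polynomial $g$ of degree $d$ (scalar- or vector-valued), its polarization is the unique symmetric $d$-linear form $G$ with $G(x,\dots,x)=g(x)$. For a possibly nonhomogeneous polynomial map $g$ on $\mathbb{R}^n$ of degree $\le d$, its homogenization is $\tilde g(x,z)=z^dg(x/z)$ on $\mathbb{R}^{n+1}$, and $\mathrm{pol}_d\,g(x_0,\dots,x_{d-1})$ denotes the polarization of $\tilde g$ evaluated at $(x_0,1),\dots,(x_{d-1},1)$ (componentwise for vector-valued $g$). The map is defined where the defining equation, which is affine in $x_2$, is uniquely solvable for $x_2$. A rational function $F(x_0,x_1)$ is a first integral of the map if $F(x_1,x_2)=F(x_0,x_1)$ whenever both sides are defined. The expansion in $\varepsilon$ is understood at points where it makes sense generically, i.e. where $\widetilde M_0=I+h^2\begin{pmatrix}K&0\\0&0\end{pmatrix}\widetilde V(y_0,y_1,\cdot,\cdot)$ is invertible. *)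

(* Defs.v *)
From HB Require Import structures.
From mathcomp Require Import all_boot all_order all_algebra all_fingroup.
From mathcomp Require Import mpoly.

Set Implicit Arguments.
Unset Strict Implicit.
Unset Printing Implicit Defensive.

Import GRing.Theory.
Local Open Scope ring_scope.

(* Multinomials and MathComp-Analysis cannot be imported together, because
   their notations clash; everything that mentions polynomials explicitly is
   therefore wrapped here, in notation-free form for client files. *)

Definition peval (R : comNzRingType) (m : nat) (p : {mpoly R[m]})
  (y : 'cV[R]_m) : R := p.@[fun i => y i 0].

(* [msize] is the total degree plus one, and 0 for the zero polynomial. *)
Definition degree_le (R : nzRingType) (m : nat) (d : nat) (p : {mpoly R[m]}) :
  bool := (msize p <= d.+1)%N.

(* The point (x, z) of R^(n+1). *)
Definition pt (R : pzSemiRingType) (n : nat) (x : 'cV[R]_n) (z : R) :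
  'cV[R]_(n + 1) := col_mx x (z%:M : 'M_1).

Definition homogenize_mnm (n d : nat) (m : 'X_{1..n}) : 'X_{1..n + 1} :=
  [multinom match split i with inl j => m j | inr _ => (d - mdeg m)%N end
    | i < n + 1].

(* Degree-d homogenization of p, meaningful when p has degree at most d: every
   monomial x^m is multiplied by z^(d - |m|), z being the last variable. See
   [homogenizeE] for the identity z^d p(x/z). *)
Definition homogenize (R : nzRingType) (n d : nat) (p : {mpoly R[n]}) :
  {mpoly R[n + 1]} :=
  \sum_(m <- msupp p) p@_m *: 'X_[homogenize_mnm d m].

Lemma homogenizeE (R : fieldType) (n d : nat) (p : {mpoly R[n]}) x (z : R) :
  degree_le d p -> z != 0 ->
  peval (homogenize d p) (pt x z) = z ^+ d * peval p (z^-1 *: x).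
Proof.
move=> dp z0; rewrite /peval /homogenize [in RHS](mpolyE p) !raddf_sum mulr_sumr /=.
apply: eq_big_seq => m mp; rewrite !mevalZ !mevalX mulrCA; congr (_ * _).
rewrite big_split_ord /= big_ord1 /homogenize_mnm !mnmE.
rewrite (unsplitK (inr ord0)) /pt col_mxEd mxE eqxx mulr1n.
have md : (mdeg m <= d)%N by rewrite -ltnS (leq_trans (msize_mdeg_lt mp)).
under eq_bigr => i _ do rewrite mnmE (unsplitK (inl i)) col_mxEu.
under [in RHS]eq_bigr => i _ do rewrite mxE exprMn.
rewrite big_split prodrXr -mdegE /= -[in RHS](subnK md) exprD.
rewrite mulrC -mulrA; congr (_ * _).
by rewrite mulrA -exprMn divff // expr1n mul1r.
Qed.

Definition tuple_set (T : Type) (d : nat) (t : d.-tuple T) (i : 'I_d) (u : T) :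
  d.-tuple T := [tuple if j == i then u else tnth t j | j < d].

Definition sym_multilinear (R : nzRingType) (X U : lmodType R) (d : nat)
  (G : d.-tuple X -> U) : Prop :=
  (forall (s : 'S_d) (t : d.-tuple X), G [tuple tnth t (s i) | i < d] = G t) /\
  (forall (t : d.-tuple X) (i : 'I_d) (a : R) (u v : X),
     G (tuple_set t i (a *: u + v)) =
     a *: G (tuple_set t i u) + G (tuple_set t i v)).

Definition is_polarization (R : nzRingType) (X U : lmodType R) (d : nat)
  (g : X -> U) (G : d.-tuple X -> U) : Prop :=
  sym_multilinear G /\ forall x : X, G [tuple x | _ < d] = g x.

(* [P] is pol_d g, for the polynomial map g given by its components. *)
Definition is_pol (R : comNzRingType) (n k d : nat)
  (g : 'cV[{mpoly R[n]}]_k) (P : d.-tuple 'cV[R]_n -> 'cV[R]_k) : Prop :=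
  exists G : d.-tuple 'cV[R]_(n + 1) -> 'cV[R]_k,
    is_polarization (fun y => \col_i peval (homogenize d (g i 0)) y) G /\
    forall t, P t = G [tuple pt (tnth t i) 1 | i < d].

Definition gradient (R : nzRingType) (n : nat) (W : {mpoly R[n]}) :
  'cV[{mpoly R[n]}]_n := \col_i W^`M(i).

(* The polynomial vector field f = - K grad W. *)
Definition vfield (R : nzRingType) (n : nat) (K : 'M[R]_n) (W : {mpoly R[n]}) :
  'cV[{mpoly R[n]}]_n := - (map_mx (@mpolyC n R) K *m gradient W).

(* The matrix S with u^T S v = V(y0, y1, u, v); see [formmxE]. *)
Definition formmx (R : comNzRingType) (m : nat) (V : 4.-tuple 'cV[R]_m -> R^o)
  (y0 y1 : 'cV[R]_m) : 'M[R]_m :=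
  \matrix_(i, j) V [tuple y0; y1; delta_mx i 0; delta_mx j 0].

Section FormMx.
Variables (R : comNzRingType) (m : nat) (V : 4.-tuple 'cV[R]_m -> R^o).
Hypothesis VL : sym_multilinear V.

Let V2 y0 y1 (a : R) u u' v : V [tuple y0; y1; a *: u + u'; v] =
  a * V [tuple y0; y1; u; v] + V [tuple y0; y1; u'; v].
Proof.
have := VL.2 [tuple y0; y1; u; v] (inord 2) a u u'.
have E w : tuple_set [tuple y0; y1; u; v] (inord 2) w = [tuple y0; y1; w; v].
  apply: eq_from_tnth => j; rewrite tnth_mktuple -val_eqE /= inordK //.
  by case: j => [[|[|[|[|j]]]] //= lj]; rewrite !(tnth_nth 0).
by rewrite !E.
Qed.

Let V3 y0 y1 (a : R) u v v' : V [tuple y0; y1; u; a *: v + v'] =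
  a * V [tuple y0; y1; u; v] + V [tuple y0; y1; u; v'].
Proof.
have := VL.2 [tuple y0; y1; u; v] (inord 3) a v v'.
have E w : tuple_set [tuple y0; y1; u; v] (inord 3) w = [tuple y0; y1; u; w].
  apply: eq_from_tnth => j; rewrite tnth_mktuple -val_eqE /= inordK //.
  by case: j => [[|[|[|[|j]]]] //= lj]; rewrite !(tnth_nth 0).
by rewrite !E.
Qed.

Let lincomb (f : 'cV[R]_m -> R) (u : 'cV[R]_m) :
  (forall (a : R) x y, f (a *: x + y) = a * f x + f y) ->
  f u = \sum_i u i 0 * f (delta_mx i 0).
Proof.
move=> fL; have f0 : f 0 = 0.
  have := fL 1 0 0; rewrite scale1r addr0 mul1r => /eqP.
  by rewrite -subr_eq subrr => /eqP <-.
rewrite {1}[u]matrix_sum_delta.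
under eq_bigr => i _ do rewrite big_ord1.
elim: (index_enum _) => [|i s IH]; first by rewrite !big_nil.
by rewrite !big_cons fL IH.
Qed.

Lemma formmxE y0 y1 (u v : 'cV[R]_m) :
  (u^T *m formmx V y0 y1 *m v) 0 0 = V [tuple y0; y1; u; v].
Proof.
rewrite (lincomb (f := fun u => V [tuple y0; y1; u; v])) //.
under [RHS]eq_bigr => i _ do
  rewrite (lincomb (f := fun v => V [tuple y0; y1; delta_mx i 0; v])) //.
rewrite -mulmxA mxE; apply: eq_bigr => i _; rewrite !mxE; congr (_ * _).
by apply: eq_bigr => j _; rewrite !mxE mulrC.
Qed.
End FormMx.

(* The block matrix diag(K, e); at e = 0 it is the matrix occurring in M_0. *)
Definition Ktilde (R : pzSemiRingType) (n : nat) (K : 'M[R]_n) (e : R) :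
  'M[R]_(n + 1) := block_mx K 0 0 (e%:M : 'M_1).

Definition Mtilde (R : comNzRingType) (n : nat) (K : 'M[R]_n) (h : R)
  (V : 4.-tuple 'cV[R]_(n + 1) -> R^o) (e : R) (y0 y1 : 'cV[R]_(n + 1)) :
  'M[R]_(n + 1) := 1%:M + h ^+ 2 *: (Ktilde K e *m formmx V y0 y1).

(* [invmx A] is the inverse of A only when A is invertible; [Feps] is used
   where M_0 is invertible and e is nonzero and close to 0. *)
Definition Feps (R : fieldType) (n : nat) (K : 'M[R]_n) (h : R)
  (V : 4.-tuple 'cV[R]_(n + 1) -> R^o) (e : R) (y0 y1 : 'cV[R]_(n + 1)) : R :=
  let Ki := invmx (Ktilde K e) in
  let Mi := invmx (Mtilde K h V e y0 y1) in
  ((y1 - y0)^T *m Ki *m Mi *m (y1 - y0)) 0 0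
  - 2^-1 * (y0^T *m Ki *m (Mi - 1%:M) *m y1) 0 0.

(* A rational function of (y0, y1), given by a fraction of polynomials and
   defined where the denominator does not vanish. *)
Record ratfun2 (R : comNzRingType) (m : nat) := RatFun2 {
  rf_num : {mpoly R[m + m]};
  rf_den : {mpoly R[m + m]};
  _ : rf_den != 0 }.

Definition rf_defined (R : comNzRingType) (m : nat) (F : ratfun2 R m)
  (y0 y1 : 'cV[R]_m) : Prop := peval (rf_den F) (col_mx y0 y1) != 0.

Definition rf_val (R : fieldType) (m : nat) (F : ratfun2 R m)
  (y0 y1 : 'cV[R]_m) : R :=
  peval (rf_num F) (col_mx y0 y1) / peval (rf_den F) (col_mx y0 y1).

(* x2 is the image component at (x0, x1): the map is defined at (x0, x1) iff
   the equation has exactly one solution. *)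
Definition step (R : nzRingType) (n : nat) (h : R)
  (pol3f : 3.-tuple 'cV[R]_n -> 'cV[R]_n) (x0 x1 x2 : 'cV[R]_n) : Prop :=
  unique (fun x => x - 2 *: x1 + x0 = h ^+ 2 *: pol3f [tuple x0; x1; x]) x2.

(* F is a function on R^n x R^n with domain [dom]. *)
Definition first_integral (T U : Type) (map : T -> T -> T -> Prop)
  (dom : T -> T -> Prop) (F : T -> T -> U) : Prop :=
  forall x0 x1 x2 : T,
    map x0 x1 x2 -> dom x0 x1 -> dom x1 x2 -> F x1 x2 = F x0 x1.

(* Main.v *)
Require Import Defs.
From HB Require Import structures.
From mathcomp Require Import all_boot all_order all_algebra.
From mathcomp Require Import perm ring.
From mathcomp Require mpoly.

(** Write c = h^2, S for the matrix of V(y0,y1,.,.), K_e = diag(K, e) and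
    M_e = 1 + c K_e S.

    The expansion. From M_e M_e^-1 = 1 one gets
    K_e^-1 (M_e^-1 - 1) = - c S M_e^-1, so the only singular part of F_e is the
    quadratic form of K_e^-1, that is the kinetic energy plus (z1 - z0)^2 / e:
      F_e = (z1 - z0)^2 / e + (x1 - x0)^T K^-1 (x1 - x0)
            + c (y0^T T_e y1 / 2 - (y1 - y0)^T T_e (y1 - y0)),
    with T_e = S M_e^-1 ([Feps_quotient]). Replacing the inverse by the adjugate
    over the determinant turns the regular part into a fraction
    [integral_num] / det M_e which commutes with ring morphisms: evaluating it
    over polynomials in e gives the limit and the O(e) remainder
    ([poly_quotient_bigO]), and evaluating it over polynomials in (y0, y1)
    exhibits F_0 as a rational function whose denominator det M_0 is 1 at the
    origin.

    The conservation law. The polarization of f = - K grad W is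
    (x0, x1, x2) |-> - K V(y0,y1,y2,.) restricted to the first n coordinates,
    where y_i = (x_i, 1) ([pol3_vfield]): both sides are symmetric trilinear,
    and on the diagonal they agree because homogenization commutes with
    differentiation. Hence the recurrence says M_0(y0,y1) y2 = 2 y1 - y0, and,
    as V is symmetric, it also says M_0(y1,y2) y0 = 2 y1 - y2. Since
      y0^T T y1 / 2 - (y1 - y0)^T T (y1 - y0) = (2 y1 - y0)^T T (y0 - y1 / 2)
    for symmetric T, and T (2 y1 - y0) = S y2, the bracket at (y0, y1) is
    V(y0,y1,y2,y0) - V(y0,y1,y2,y1) / 2 ([step_mx_bracket]); the one at
    (y1, y2) is obtained by exchanging y0 and y2. Their difference
    V(y0,y1,y2,y2 - y0) is compensated by the change of the kinetic energy,
    (x2 - 2 x1 + x0)^T K^-1 (x2 - x0) = - c V(y0,y1,y2,y2 - y0)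
    ([F0_conserved]). *)

Import Order.TTheory GRing.Theory Num.Theory.
Local Open Scope ring_scope.

Module ConservedQuantity.
Import ssrcomplements mpoly.

(** * Homogenization and partial derivatives *)
Section Homogenization.
Context {R : nzRingType} {n : nat}.
Implicit Types p q : {mpoly R[n]}.

(** A range of monomials that depends only on a bound for the degree of [p],
    so that the sums for two polynomials can be added term by term. *)
Lemma homogenize_bounded d p k : (msize p <= k)%N ->
  homogenize d p =
  \sum_(m : 'X_{1..n < k}) p@_m *: 'X_[homogenize_mnm d m].
Proof.
move=> pk; pose I : subFinType _ := 'X_{1..n < k}.
rewrite /homogenize (big_mksub I) //=; first last.
- by move=> m /msize_mdeg_lt /leq_trans; apply.
- exact: msupp_uniq.
by rewrite big_rmcond //= => m /memN_msupp_eq0 ->; rewrite scale0r.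
Qed.

Lemma homogenize_is_linear d : linear (@homogenize R n d).
Proof.
move=> a p q; pose k := maxn (msize (a *: p + q)) (maxn (msize p) (msize q)).
rewrite !(@homogenize_bounded d _ k) ?leq_max ?leqnn ?orbT //.
rewrite scaler_sumr -big_split /=.
by apply: eq_bigr => m _; rewrite mcoeffD mcoeffZ scalerDl scalerA.
Qed.

HB.instance Definition _ d := GRing.isLinear.Build R {mpoly R[n]}
  {mpoly R[n + 1]} _ (@homogenize R n d) (homogenize_is_linear d).

Lemma homogenizeN d : {morph @homogenize R n d : p / - p}.
Proof. exact: linearN. Qed.

Lemma homogenizeZ d c : {morph @homogenize R n d : p / c *: p}.
Proof. exact: linearZ. Qed.

Lemma homogenize_sum d (I : Type) (r : seq I) (F : I -> {mpoly R[n]}) :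
  homogenize d (\sum_(i <- r) F i) = \sum_(i <- r) homogenize d (F i).
Proof. exact: linear_sum. Qed.

Lemma homogenizeX d m :
  homogenize d 'X_[m] = 'X_[homogenize_mnm d m] :> {mpoly R[n + 1]}.
Proof. by rewrite /homogenize msuppX big_seq1 mcoeffX eqxx scale1r. Qed.

(** By linearity it suffices to look at a monomial x^m. Differentiating lowers
    the degree and the target degree d+1 together, so the power of the
    homogenizing variable is the same on both sides. If the exponent of x_j is
    zero, both sides vanish. *)
Lemma homogenize_mderiv d p (j : 'I_n) :
  homogenize d p^`M(j) = (homogenize d.+1 p)^`M(lshift 1 j).
Proof.
elim/mpolyind: p => [|c m p _ _ IH]; first by rewrite !linear0.
rewrite !linearP /= {}IH; congr (c *: _ + _).
rewrite homogenizeX !mderivX linearZ /= homogenizeX.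
rewrite [homogenize_mnm _ m _]mnmE (unsplitK (inl j)).
have [->|mj0] := posnP (m j); first by rewrite !scale0r.
congr (_ *: 'X_[_]); apply/mnmP => i; rewrite mnmBE !mnmE.
case: splitP => [i' ii'|i' ii'].
  rewrite (_ : i = lshift 1 i') ?eq_lshift ?mnmE //.
  exact: val_inj.
rewrite (_ : (_ == i) = false) ?subn0.
  have jm : (U_(j) <= m)%MM by rewrite lep1mP -lt0n.
  rewrite -{2}(submK jm) mdegD mdeg1 addn1 subSS //.
by apply/eqP => /(congr1 val) /= /eqP; rewrite ii' ltn_eqF // ltn_addr.
Qed.

End Homogenization.

Section Evaluation.
Context {R : comNzRingType} {m : nat}.

(** Evaluation with the point first, so that it can carry a ring morphism
    structure. *)
Definition peval_at (y : 'cV[R]_m) (p : {mpoly R[m]}) : R := peval p y.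

HB.instance Definition _ y := GRing.RMorphism.copy (peval_at y)
  (meval (fun i => y i 0)).

Lemma peval_atZ y c (p : {mpoly R[m]}) :
  peval_at y (c *: p) = c * peval_at y p.
Proof. exact: mevalZ. Qed.
End Evaluation.

Section DirectionalDerivative.
Context {R : comNzRingType} {m : nat}.
Implicit Types p q : {mpoly R[m]}.

(** The chain rule for the substitution of univariate polynomials. The
    polynomials [p] that satisfy it contain the constants and the variables and
    are closed under sums and products (Leibniz), hence are all of them. *)
Lemma deriv_mmap p (u : 'I_m -> {poly R}) :
  (mmap polyC u p)^`() = \sum_k mmap polyC u p^`M(k) * (u k)^`().
Proof.
pose P q := (mmap polyC u q)^`() = \sum_k mmap polyC u q^`M(k) * (u k)^`().
have PC c : P c%:MP.
  by rewrite /P mmapC derivC big1 // => k _; rewrite mderivC rmorph0 mul0r.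
have PX i : P 'X_i.
  rewrite /P mmapX mmap1U (bigD1 i) //= mderivX mnm1E eqxx.
  rewrite -[X in (X - _)%MM]add0m addmK mpolyX0 scale1r rmorph1 mul1r.
  rewrite big1 ?addr0 // => k ki.
  by rewrite mderivX mnm1E eq_sym (negPf ki) scale0r rmorph0 mul0r.
have PM q r : P q -> P r -> P (q * r).
  rewrite /P => Pq Pr; rewrite rmorphM /= derivM Pq Pr mulr_suml mulr_sumr.
  rewrite -big_split; apply: eq_bigr => k _ /=.
  by rewrite mderivM rmorphD /= !rmorphM /= mulrDl mulrAC mulrA.
have P1 : P 1 by rewrite -mpolyC1; exact: PC.
change (P p); elim/mpolyind: p => [|c mm p _ _ IH].
  by rewrite -mpolyC0; exact: PC.
rewrite /P mmapD derivD IH -mul_mpolyC; set q := _ * _.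
have -> : (mmap polyC u q)^`() = \sum_k mmap polyC u q^`M(k) * (u k)^`().
  apply: (PM); first exact: PC.
  rewrite mpolyXE_id; apply: (big_ind P P1 PM) => i _.
  by elim: (mm i) => [|e IHe]; rewrite ?expr0 // exprS; apply: (PM).
by rewrite -big_split; apply: eq_bigr => k _ /=; rewrite mderivD rmorphD mulrDl.
Qed.

(** The directional derivative of [p] is read off algebraically, as the linear
    coefficient of its restriction to a line. *)
Lemma line_restriction p (y v : 'cV[R]_m) : exists2 q : {poly R},
  forall t, q.[t] = peval p (y + t *: v) &
  q`_1 = \sum_k peval p^`M(k) y * v k 0.
Proof.
pose u k : {poly R} := (y k 0)%:P + v k 0 *: 'X.
have uE r t : (mmap polyC u r).[t] = peval r (y + t *: v).
  rewrite /peval mevalE /mmap horner_sum; apply: eq_bigr => mm _.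
  rewrite hornerM hornerC /mmap1 horner_prod; congr (_ * _).
  by apply: eq_bigr => k _; rewrite horner_exp !hornerE !mxE mulrC.
exists (mmap polyC u p) => //.
have -> (q : {poly R}) : q`_1 = q^`().[0].
  by rewrite horner_coef0 coef_deriv mulr1n.
rewrite deriv_mmap horner_sum; apply: eq_bigr => k _.
rewrite hornerM uE scale0r addr0; congr (_ * _).
by rewrite /u !derivE !hornerE.
Qed.
End DirectionalDerivative.

(** * Symmetric multilinear forms *)
Section SymmetricForms.
Context {R : nzRingType} {X U : lmodType R} {d : nat} {G : d.-tuple X -> U}.
Hypothesis GL : sym_multilinear G.

Lemma sym_multilinear_perm (s t : d.-tuple X) : perm_eq s t -> G s = G t.
Proof.
by case/tuple_permP => p sE; rewrite -(GL.1 p t); congr G; apply: val_inj.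
Qed.

(** Linearity in the slot [i], for a family [T] of tuples written explicitly
    instead of through [tuple_set]. *)
Lemma sym_multilinear_at (i : 'I_d) (T : X -> d.-tuple X) (t : d.-tuple X) :
  (forall u, tuple_set t i u = T u) ->
  forall k u v, G (T (k *: u + v)) = k *: G (T u) + G (T v).
Proof. by move=> tT k u v; rewrite -!tT; exact: GL.2. Qed.
End SymmetricForms.

Section TrilinearForms.
Context {R : nzRingType} {X U : lmodType R} {G : 3.-tuple X -> U}.
Hypothesis GL : sym_multilinear G.

Lemma trilinear_swap01 a b c : G [tuple b; a; c] = G [tuple a; b; c].
Proof.
apply: (sym_multilinear_perm GL _ _).
exact/permPl/(perm_catCA [:: b] [:: a] [:: c]).
Qed.

Lemma trilinear_swap12 a b c : G [tuple a; c; b] = G [tuple a; b; c].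
Proof.
apply: (sym_multilinear_perm GL _ _); rewrite perm_cons.
exact/permPl/(perm_catC [:: c] [:: b]).
Qed.

Lemma trilinearD a b u v :
  G [tuple a; b; u + v] = G [tuple a; b; u] + G [tuple a; b; v].
Proof.
have lin := sym_multilinear_at GL (inord 2)
  (fun w => [tuple a; b; w]) [tuple a; b; 0].
rewrite -[u in LHS]scale1r lin ?scale1r // => w.
apply: eq_from_tnth => j; rewrite tnth_mktuple -val_eqE /= inordK //.
by case: j => [[|[|[|j]]] //= lj]; rewrite !(tnth_nth 0).
Qed.
End TrilinearForms.

(** The bilinear form of a matrix, as a scalar. *)
Definition bil {R : pzSemiRingType} {m} (A : 'M[R]_m) (u v : 'cV[R]_m) : R :=
  (u^T *m A *m v) 0 0.

Section QuadrilinearForms.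
Context {R : comNzRingType} {m : nat} {V : 4.-tuple 'cV[R]_m -> R^o}.
Hypothesis VL : sym_multilinear V.
Implicit Types a b c d u v : 'cV[R]_m.

Lemma form_swap01 a b c d : V [tuple b; a; c; d] = V [tuple a; b; c; d].
Proof.
apply: (sym_multilinear_perm VL _ _).
exact/permPl/(perm_catCA [:: b] [:: a] [:: c; d]).
Qed.

Lemma form_swap12 a b c d : V [tuple a; c; b; d] = V [tuple a; b; c; d].
Proof.
apply: (sym_multilinear_perm VL _ _); rewrite perm_cons.
exact/permPl/(perm_catCA [:: c] [:: b] [:: d]).
Qed.

Lemma form_swap23 a b c d : V [tuple a; b; d; c] = V [tuple a; b; c; d].
Proof.
apply: (sym_multilinear_perm VL _ _); rewrite !perm_cons.
exact/permPl/(perm_catC [:: d] [:: c]).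
Qed.

Lemma form_linear a b c k u v : V [tuple a; b; c; k *: u + v] =
  k * V [tuple a; b; c; u] + V [tuple a; b; c; v].
Proof.
apply: (sym_multilinear_at VL (inord 3)
  (fun w => [tuple a; b; c; w]) [tuple a; b; c; 0]) => w.
apply: eq_from_tnth => j; rewrite tnth_mktuple -val_eqE /= inordK //.
by case: j => [[|[|[|[|j]]]] //= lj]; rewrite !(tnth_nth 0).
Qed.

Lemma bil_formmx a b u v : bil (formmx V a b) u v = V [tuple a; b; u; v].
Proof. exact: formmxE. Qed.

(** The form in its first two arguments is again a matrix: this is what makes
    the entries of [formmx V a b] polynomial in the coordinates of [a], [b]. *)
Lemma formmx_bil a b u v : V [tuple a; b; u; v] = bil (formmx V u v) a b.
Proof.
by rewrite bil_formmx form_swap12 form_swap01 form_swap23 form_swap12.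
Qed.

Lemma formmx_mulE a b c j :
  (formmx V a b *m c) j 0 = V [tuple a; b; c; delta_mx j 0].
Proof.
by rewrite form_swap23 -bil_formmx /bil trmx_delta -mulmxA -rowE [in RHS]mxE.
Qed.

Lemma formmx_sym a b : (formmx V a b)^T = formmx V a b.
Proof. by apply/matrixP => i j; rewrite !mxE form_swap23. Qed.

(** Both sides represent the linear form V(a,b,c,.); this is the source of the
    time-reversal symmetry of the map. *)
Lemma formmx_rotate a b c : formmx V a b *m c = formmx V b c *m a.
Proof.
apply/colP => j; rewrite !formmx_mulE.
by rewrite -form_swap01 -[in RHS]form_swap12.
Qed.

(** The coefficient of [t] is what identifies the gradient of a quartic form. *)
Lemma form_line a v t :
  let w := a + t *: v in
  V [tuple w; w; w; w] =
  V [tuple a; a; a; a] + 4 * t * V [tuple a; a; a; v]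
  + 6 * t ^+ 2 * V [tuple a; a; v; v] + 4 * t ^+ 3 * V [tuple a; v; v; v]
  + t ^+ 4 * V [tuple v; v; v; v].
Proof.
move=> w; have l3 x y z :
    V [tuple x; y; z; w] = t * V [tuple x; y; z; v] + V [tuple x; y; z; a].
  by rewrite /w addrC form_linear.
have l2 x y z :
    V [tuple x; y; w; z] = t * V [tuple x; y; v; z] + V [tuple x; y; a; z].
  by rewrite !(form_swap23 x y z) l3.
have l1 x y z :
    V [tuple x; w; y; z] = t * V [tuple x; v; y; z] + V [tuple x; a; y; z].
  by rewrite !(form_swap12 x y _ z) l2.
have l0 x y z :
    V [tuple w; x; y; z] = t * V [tuple v; x; y; z] + V [tuple a; x; y; z].
  by rewrite !(form_swap01 x _ y z) l1.
rewrite !(l0, l1, l2, l3) !(form_swap01 a v, form_swap12 _ a v,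
  form_swap23 _ _ a v).
ring.
Qed.
End QuadrilinearForms.

Section Polarization.
Context {R : numFieldType}.

Lemma horner_inj (p q : {poly R}) : (forall t, p.[t] = q.[t]) -> p = q.
Proof.
move=> pq; apply/eqP; rewrite -subr_eq0; apply/eqP.
apply: (@roots_geq_poly_eq0 _ _ [seq k%:R | k <- iota 0 (size (p - q))]).
- by apply/allP => t _; rewrite /root !hornerE pq subrr.
- by rewrite map_inj_uniq ?iota_uniq // => i j /eqP; rewrite eqr_nat => /eqP.
- by rewrite size_map size_iota.
Qed.

Definition sym_trilinear {X : zmodType} (g : X -> X -> X -> R) : Prop :=
  [/\ forall a b c, g b a c = g a b c,
      forall a b c, g a c b = g a b c &
      forall a b u v, g a b (u + v) = g a b u + g a b v].

(** Inclusion-exclusion: in the alternating sum over subsets of {a, b, c} only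
    the six terms in which each vector occurs once survive. *)
Lemma sym_trilinear_diag {X : zmodType} {g : X -> X -> X -> R} :
  sym_trilinear g ->
  let q x := g x x x in
  forall a b c, g a b c =
    6^-1 * (q (a + b + c) - q (a + b) - q (a + c) - q (b + c)
            + q a + q b + q c).
Proof.
move=> [s01 s12 l2] q a b c; rewrite /q.
have l1 x u v z : g x (u + v) z = g x u z + g x v z.
  by rewrite !(s12 x z) l2.
have l0 u v y z : g (u + v) y z = g u y z + g v y z.
  by rewrite !(s01 y _) l1.
rewrite !(l0, l1, l2) !(s01 a b, s01 a c, s01 b c, s12 _ a b, s12 _ a c,
  s12 _ b c).
by field.
Qed.

Lemma eq_sym_trilinear {X : zmodType} {g g' : X -> X -> X -> R} :
  sym_trilinear g -> sym_trilinear g' -> (forall x, g x x x = g' x x x) ->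
  forall a b c, g a b c = g' a b c.
Proof.
by move=> gL gL' gg' a b c; rewrite (sym_trilinear_diag gL)
  (sym_trilinear_diag gL') !gg'.
Qed.
End Polarization.

(** * Polarization of the vector field *)
Section VectorField.
Context {R : numFieldType}.

(** Both sides are the coefficient of t in the univariate polynomial
    p (y + t v), computed by the chain rule and by multilinearity. *)
Lemma gradient_quartic m (p : {mpoly R[m]}) (V : 4.-tuple 'cV[R]_m -> R^o)
    (VL : sym_multilinear V)
    (pV : forall y, peval p y = 4^-1 * V [tuple y; y; y; y])
    (y v : 'cV[R]_m) :
  \sum_k peval (p^`M(k)) y * v k 0 = V [tuple y; y; y; v].
Proof.
have [q qE <-] := line_restriction p y v.
pose r := Poly [:: 4^-1 * V [tuple y; y; y; y]; V [tuple y; y; y; v];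
  3 / 2 * V [tuple y; y; v; v]; V [tuple y; v; v; v];
  4^-1 * V [tuple v; v; v; v]].
suff -> : q = r by rewrite coef_Poly.
apply: horner_inj => t; rewrite qE pV form_line // horner_Poly /=.
by field.
Qed.

Context {n : nat} {K : 'M[R]_n} {W : {mpoly R[n]}}.
Context {V : 4.-tuple 'cV[R]_(n + 1) -> R^o}.
Hypothesis VL : sym_multilinear V.
Hypothesis WV : forall y,
  peval (homogenize 4 W) y = 4^-1 * V [tuple y; y; y; y].

Lemma homogenize_vfield i y :
  peval (homogenize 3 (vfield K W i 0)) y =
  - \sum_j K i j * V [tuple y; y; y; delta_mx (lshift 1 j) 0].
Proof.
rewrite !mxE homogenizeN homogenize_sum -[peval _ _]/(peval_at y _).
rewrite rmorphN rmorph_sum; congr (- _).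
apply: eq_bigr => j _; rewrite !mxE mul_mpolyC homogenizeZ /= peval_atZ.
congr (_ * _); rewrite homogenize_mderiv /peval_at.
rewrite -(gradient_quartic _ _ _ VL WV) (bigD1 (lshift 1 j)) //= mxE !eqxx.
by rewrite mulr1 big1 ?addr0 // => k kj; rewrite mxE (negPf kj) mulr0.
Qed.

(** Symmetric trilinear maps are determined by their diagonal, where
    [homogenize_vfield] applies. *)
Lemma pol3_vfield (pol3f : 3.-tuple 'cV[R]_n -> 'cV[R]_n) x0 x1 x2 :
  is_pol (vfield K W) pol3f ->
  pol3f [tuple x0; x1; x2] =
  - (K *m usubmx (formmx V (pt x0 1) (pt x1 1) *m pt x2 1)).
Proof.
case=> G [[GL Gdiag] ->].
have -> : [tuple pt (tnth [tuple x0; x1; x2] i) 1 | i < 3] =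
    [tuple pt x0 1; pt x1 1; pt x2 1].
  apply: eq_from_tnth => j; rewrite tnth_mktuple.
  by case: j => [[|[|[|j]]] lj] //; rewrite !(tnth_nth 0).
apply/colP => i; set y0 := pt x0 1; set y1 := pt x1 1; set y2 := pt x2 1.
pose g a b c := G [tuple a; b; c] i 0.
pose g' a b c := - \sum_j K i j * V [tuple a; b; c; delta_mx (lshift 1 j) 0].
have -> : (- (K *m usubmx (formmx V y0 y1 *m y2))) i 0 = g' y0 y1 y2.
  rewrite !mxE; congr (- _); apply: eq_bigr => j _.
  by rewrite [usubmx _ _ _]mxE formmx_mulE.
have gg' y : g y y y = g' y y y.
  rewrite /g' -homogenize_vfield.
  have := Gdiag y; rewrite (_ : [tuple y | _ < 3] = [tuple y; y; y]).
    by move/colP => /(_ i); rewrite mxE.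
  apply: eq_from_tnth => j; rewrite tnth_mktuple.
  by case: j => [[|[|[|j]]] lj] //; rewrite !(tnth_nth 0).
apply: (eq_sym_trilinear _ _ gg').
- split=> a b c *; rewrite /g; first by rewrite (trilinear_swap01 GL).
    by rewrite (trilinear_swap12 GL).
  by rewrite (trilinearD GL) mxE.
split=> a b c; [| |move=> x]; rewrite /g'.
- by under eq_bigr do rewrite (form_swap01 VL).
- by under eq_bigr do rewrite (form_swap12 VL).
rewrite -opprD -big_split; congr (- _); apply: eq_bigr => j _ /=.
rewrite -mulrDr !(form_swap23 VL _ _ (delta_mx _ _)).
have := form_linear VL a b (delta_mx (lshift 1 j) 0) 1 c x.
by rewrite scale1r mul1r => ->.
Qed.
End VectorField.

(** * The regular part of the integral *)
Section BilinearForm.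
Context {R : comNzRingType} {m : nat}.
Implicit Types (A B : 'M[R]_m) (u v w : 'cV[R]_m).

Lemma bilDl A u v w : bil A (u + v) w = bil A u w + bil A v w.
Proof. by rewrite /bil linearD !mulmxDl mxE. Qed.

Lemma bilDr A u v w : bil A u (v + w) = bil A u v + bil A u w.
Proof. by rewrite /bil mulmxDr mxE. Qed.

Lemma bilZl A k u v : bil A (k *: u) v = k * bil A u v.
Proof. by rewrite /bil linearZ -!scalemxAl mxE. Qed.

Lemma bilZr A k u v : bil A u (k *: v) = k * bil A u v.
Proof. by rewrite /bil -scalemxAr mxE. Qed.

Lemma bilNl A u v : bil A (- u) v = - bil A u v.
Proof. by rewrite -scaleN1r bilZl mulN1r. Qed.

Lemma bilNr A u v : bil A u (- v) = - bil A u v.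
Proof. by rewrite -scaleN1r bilZr mulN1r. Qed.

Definition bilE := (bilDl, bilDr, bilNl, bilNr, bilZl, bilZr).

Lemma bil_mxB A B u v : bil (A - B) u v = bil A u v - bil B u v.
Proof. by rewrite /bil mulmxBr mulmxBl !mxE. Qed.

Lemma bil_mxZ k A u v : bil (k *: A) u v = k * bil A u v.
Proof. by rewrite /bil -scalemxAr -scalemxAl mxE. Qed.

Lemma bil_sym A u v : A^T = A -> bil A u v = bil A v u.
Proof.
move=> AT; transitivity ((u^T *m A *m v)^T 0 0); first by rewrite mxE.
by rewrite !trmx_mul trmxK AT mulmxA.
Qed.
End BilinearForm.

Section Numerator.

(** With [c = h ^+ 2], [Q = Ktilde K e] and [S = formmx V y0 y1] this is
    [Mtilde K h V e y0 y1] by definition. It is stated over any commutative ring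
    to be used also with polynomial entries. *)
Definition step_mx {A : comNzRingType} {m} (c : A) (Q S : 'M[A]_m) : 'M[A]_m :=
  1%:M + c *: (Q *m S).

(** The regular part of [Feps] multiplied by the determinant of [step_mx c Q S],
    with the adjugate in place of the inverse; [d] stands for one half and [L]
    for diag(K^-1, 0). Being built from ring operations only, it is natural
    under ring morphisms ([rmorph_integral_num]). *)
Definition integral_num {A : comNzRingType} {m} (c d : A) (L Q S : 'M[A]_m)
    (y0 y1 : 'cV[A]_m) : A :=
  let T := S *m \adj (step_mx c Q S) in
  bil L (y1 - y0) (y1 - y0) * \det (step_mx c Q S)
  + c * (d * bil T y0 y1 - bil T (y1 - y0) (y1 - y0)).

Section Morphism.
Context {A B : comNzRingType} {m : nat} (f : {rmorphism A -> B}).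
Implicit Types (L Q S : 'M[A]_m) (y : 'cV[A]_m).

Lemma map_step_mx c Q S :
  map_mx f (step_mx c Q S) = step_mx (f c) (map_mx f Q) (map_mx f S).
Proof. by rewrite map_mxD map_mx1 map_mxZ map_mxM. Qed.

Lemma rmorph_bil L u v :
  f (bil L u v) = bil (map_mx f L) (map_mx f u) (map_mx f v).
Proof. by rewrite /bil map_trmx -!map_mxM [in RHS]mxE. Qed.

Lemma rmorph_integral_num c d L Q S y0 y1 : f (integral_num c d L Q S y0 y1) =
  integral_num (f c) (f d) (map_mx f L) (map_mx f Q) (map_mx f S)
    (map_mx f y0) (map_mx f y1).
Proof.
rewrite /integral_num rmorphD !rmorphM rmorphB rmorphM /= !rmorph_bil.
rewrite -det_map_mx.
by rewrite !map_mxB map_mxM map_mx_adj map_step_mx.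
Qed.

Lemma map_Ktilde n (K : 'M[A]_n) e :
  map_mx f (Ktilde K e) = Ktilde (map_mx f K) (f e).
Proof. by rewrite /Ktilde map_block_mx !map_mx0 map_scalar_mx. Qed.
End Morphism.

Lemma integral_num_quotient (R : fieldType) m (c d : R) (L Q S : 'M[R]_m)
    (y0 y1 : 'cV[R]_m) (T := S *m invmx (step_mx c Q S)) :
  step_mx c Q S \in unitmx ->
  integral_num c d L Q S y0 y1 / \det (step_mx c Q S) =
  bil L (y1 - y0) (y1 - y0) + c * (d * bil T y0 y1 - bil T (y1 - y0) (y1 - y0)).
Proof.
move=> Mu; have := Mu; rewrite unitmxE unitfE => detM.
have -> : T = (\det (step_mx c Q S))^-1 *: (S *m \adj (step_mx c Q S)).
  by rewrite /T /invmx Mu scalemxAr.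
rewrite /integral_num !bil_mxZ.
by field.
Qed.
End Numerator.

Section Expansion.
Context {R : fieldType} {n : nat} {K : 'M[R]_n} {h : R}.
Context {V : 4.-tuple 'cV[R]_(n + 1) -> R^o}.
Hypothesis Kns : K \in unitmx.

Lemma mul_Ktilde (A B : 'M[R]_n) a b :
  Ktilde A a *m Ktilde B b = Ktilde (A *m B) (a * b).
Proof.
rewrite /Ktilde mulmx_block !mul0mx !mulmx0 !addr0 add0r.
by rewrite -scalar_mxM.
Qed.

Lemma Ktilde1 : Ktilde 1%:M 1 = 1%:M :> 'M[R]_(n + 1).
Proof. by rewrite /Ktilde -scalar_mx_block. Qed.

Lemma invmx_Ktilde e : e != 0 -> invmx (Ktilde K e) = Ktilde (invmx K) e^-1.
Proof.
move=> e0; have KK : Ktilde K e *m Ktilde (invmx K) e^-1 = 1%:M.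
  by rewrite mul_Ktilde mulmxV // divff // Ktilde1.
have [Ku _] := mulmx1_unit KK.
by rewrite -[LHS]mulmx1 -KK mulKmx.
Qed.

Lemma bil_Ktilde (A : 'M[R]_n) a x x' z z' :
  bil (Ktilde A a) (pt x z) (pt x' z') = bil A x x' + a * z * z'.
Proof.
rewrite /bil /Ktilde /pt tr_col_mx mul_row_block mul_row_col !mulmx0 addr0.
rewrite add0r mxE tr_scalar_mx -!scalar_mxM; congr (_ + _).
by rewrite mxE eqxx mulr1n [z * a]mulrC.
Qed.

Lemma ptB (x x' : 'cV[R]_n) z z' : pt x z - pt x' z' = pt (x - x') (z - z').
Proof. by rewrite /pt opp_col_mx add_col_mx raddfB. Qed.

(** The pole at e = 0 comes only from the last entry of the inverse of
    [Ktilde K e]: the remaining terms contain the inverse of [Mtilde] preceded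
    by [formmx V y0 y1], with no inverse of [Ktilde K e] left. *)
Lemma Feps_quotient e x0 x1 z0 z1 (y0 := pt x0 z0) (y1 := pt x1 z1) :
  e != 0 -> Mtilde K h V e y0 y1 \in unitmx ->
  Feps K h V e y0 y1 = e^-1 * (z1 - z0) ^+ 2
    + integral_num (h ^+ 2) 2^-1 (Ktilde (invmx K) 0) (Ktilde K e)
        (formmx V y0 y1) y0 y1
      / \det (Mtilde K h V e y0 y1).
Proof.
move=> e0 Mu; rewrite -[Mtilde K h V e y0 y1]/(step_mx _ _ _).
rewrite integral_num_quotient //.
set M := step_mx _ _ _; set S := formmx V y0 y1; set c := h ^+ 2.
have MD : M - 1%:M = c *: (Ktilde K e *m S) by rewrite addrC addKr.
have Ku : Ktilde K e \in unitmx.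
  rewrite unitmxE /Ktilde det_ublock det_scalar1 unitrM -unitmxE Kns.
  by rewrite unitfE.
have KM : invmx (Ktilde K e) *m (invmx M - 1%:M) = - (c *: (S *m invmx M)).
  have -> : invmx M - 1%:M = - ((M - 1%:M) *m invmx M).
    by rewrite mulmxBl mulmxV // mul1mx opprB.
  by rewrite MD mulmxN -scalemxAl -scalemxAr -!mulmxA mulKmx.
have KM1 : invmx (Ktilde K e) *m invmx M =
    invmx (Ktilde K e) - c *: (S *m invmx M).
  by rewrite -KM mulmxBr mulmx1 addrC subrK.
rewrite /Feps -[Mtilde K h V e y0 y1]/M.
rewrite -!(mulmxA _ (invmx (Ktilde K e))) KM1 KM.
rewrite -![((_^T *m _ *m _) 0 0)]/(bil _ _ _) bil_mxB -scaleNr !bil_mxZ.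
rewrite invmx_Ktilde // ptB !bil_Ktilde.
by ring.
Qed.

(** The same formulas over univariate polynomials, with the indeterminate in
    place of [e]. *)
Lemma Feps_fraction_poly y0 y1 : exists P D : {poly R}, forall e,
  P.[e] = integral_num (h ^+ 2) 2^-1 (Ktilde (invmx K) 0) (Ktilde K e)
            (formmx V y0 y1) y0 y1 /\
  D.[e] = \det (Mtilde K h V e y0 y1).
Proof.
pose C p q (A : 'M[R]_(p, q)) := map_mx polyC A.
exists (integral_num (h ^+ 2)%:P 2^-1%:P (C _ _ (Ktilde (invmx K) 0))
  (Ktilde (C _ _ K) 'X) (C _ _ (formmx V y0 y1)) (C _ _ y0) (C _ _ y1)).
exists (\det (step_mx (h ^+ 2)%:P (Ktilde (C _ _ K) 'X)
  (C _ _ (formmx V y0 y1)))).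
move=> e; have CK p q (A : 'M[R]_(p, q)) : map_mx (horner_eval e) (C _ _ A) = A.
  by apply/matrixP => i j; rewrite !mxE /horner_eval hornerC.
have KX : map_mx (horner_eval e) (Ktilde (C _ _ K) 'X) = Ktilde K e.
  by rewrite map_Ktilde CK /= /horner_eval hornerX.
rewrite -[_.[e]]/(horner_eval e _) -[X in _ /\ X = _]/(horner_eval e _).
rewrite rmorph_integral_num -det_map_mx map_step_mx !CK !KX /=.
by rewrite /horner_eval !hornerC.
Qed.
End Expansion.

(** * The limit as a rational function *)
Section RationalFunction.
Context {R : fieldType} {m : nat} {V : 4.-tuple 'cV[R]_m -> R^o}.
Hypothesis VL : sym_multilinear V.

Definition var0 : 'cV[{mpoly R[m + m]}]_m := \col_i 'X_(lshift m i).
Definition var1 : 'cV[{mpoly R[m + m]}]_m := \col_i 'X_(rshift m i).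
(** The matrix [formmx V y0 y1] with indeterminate [y0] and [y1]. *)
Definition form_poly : 'M[{mpoly R[m + m]}]_m := \matrix_(i, j)
  bil (map_mx (@mpolyC _ R) (formmx V (delta_mx i 0) (delta_mx j 0))) var0 var1.

Definition mxC p q (A : 'M[R]_(p, q)) : 'M[{mpoly R[m + m]}]_(p, q) :=
  map_mx (@mpolyC _ R) A.

Definition integral_num_mpoly (c : R) (L Q : 'M[R]_m) : {mpoly R[m + m]} :=
  integral_num c%:MP 2^-1%:MP (mxC _ _ L) (mxC _ _ Q) form_poly var0 var1.
Definition step_det_mpoly (c : R) (Q : 'M[R]_m) : {mpoly R[m + m]} :=
  \det (step_mx c%:MP (mxC _ _ Q) form_poly).

Section Eval.
Variables y0 y1 : 'cV[R]_m.
Let ev : {rmorphism {mpoly R[m + m]} -> R} := peval_at (col_mx y0 y1).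

Let ev_var0 : map_mx ev var0 = y0.
Proof.
apply/colP => i; rewrite !mxE /= /peval_at /peval mevalXU.
by rewrite (col_mxEu y0).
Qed.

Let ev_var1 : map_mx ev var1 = y1.
Proof.
apply/colP => i; rewrite !mxE /= /peval_at /peval mevalXU.
by rewrite (col_mxEd y0).
Qed.

Let evC c : ev c%:MP = c. Proof. exact: mevalC. Qed.

Let ev_mxC p q (A : 'M[R]_(p, q)) : map_mx ev (mxC _ _ A) = A.
Proof. by apply/matrixP => i j; rewrite !mxE evC. Qed.

Let ev_form : map_mx ev form_poly = formmx V y0 y1.
Proof.
apply/matrixP => i j; rewrite !mxE rmorph_bil ev_var0 ev_var1 ev_mxC.
by rewrite (formmx_bil VL).
Qed.

Lemma peval_integral_num_mpoly c L Q :
  peval (integral_num_mpoly c L Q) (col_mx y0 y1) =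
  integral_num c 2^-1 L Q (formmx V y0 y1) y0 y1.
Proof.
rewrite -[LHS]/(ev _) rmorph_integral_num ev_var0 ev_var1 ev_form !ev_mxC.
by rewrite !evC.
Qed.

Lemma peval_step_det_mpoly c Q : peval (step_det_mpoly c Q) (col_mx y0 y1) =
  \det (step_mx c Q (formmx V y0 y1)).
Proof.
rewrite -[LHS]/(ev _) /step_det_mpoly -det_map_mx map_step_mx.
by rewrite ev_form ev_mxC evC.
Qed.
End Eval.

(** At y0 = y1 = 0 the form vanishes and the determinant is that of the
    identity. *)
Lemma step_det_mpoly_neq0 c Q : step_det_mpoly c Q != 0.
Proof.
apply/eqP => D0; have := peval_step_det_mpoly 0 0 c Q; rewrite D0 /peval meval0.
suff -> : formmx V 0 0 = 0.
  rewrite /step_mx mulmx0 scaler0 addr0 det1 => /eqP.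
  by rewrite eq_sym oner_eq0.
apply/matrixP => i j; rewrite !mxE (formmx_bil VL) /bil mulmx0.
by rewrite mxE.
Qed.

Definition F0_ratfun c L Q : ratfun2 R m :=
  RatFun2 (integral_num_mpoly c L Q) (step_det_mpoly_neq0 c Q).
End RationalFunction.

(** * Conservation along the map *)
Section FirstIntegral.
Context {R : numFieldType}.

(** From M^T S = S + c S Q S = S M, where M = 1 + c Q S. *)
Lemma transpose_inverse_sym m (c : R) (Q S : 'M[R]_m) :
  Q^T = Q -> S^T = S -> step_mx c Q S \in unitmx ->
  (S *m invmx (step_mx c Q S))^T = S *m invmx (step_mx c Q S).
Proof.
move=> QT ST Mu; rewrite trmx_mul ST trmx_inv.
have MS : (step_mx c Q S)^T *m S = S *m step_mx c Q S.
  rewrite /step_mx linearD linearZ /= trmx_mul QT ST trmx1.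
  by rewrite mulmxDl mulmxDr mulmx1 mul1mx -scalemxAl -scalemxAr mulmxA.
have MTu : (step_mx c Q S)^T \in unitmx by rewrite unitmx_tr.
by apply: (can_inj (mulKmx MTu)); rewrite mulKVmx // mulmxA MS mulmxK.
Qed.

(** The quadratic form on the left factors as
    (2 y1 - y0)^T T (y0 - y1 / 2), and T (2 y1 - y0) = S y2. *)
Lemma step_mx_bracket m (c : R) (Q S : 'M[R]_m) y0 y1 y2
    (T := S *m invmx (step_mx c Q S)) :
  Q^T = Q -> S^T = S -> step_mx c Q S \in unitmx ->
  step_mx c Q S *m y2 = 2 *: y1 - y0 ->
  2^-1 * bil T y0 y1 - bil T (y1 - y0) (y1 - y0) =
  bil S y2 y0 - 2^-1 * bil S y2 y1.
Proof.
move=> QT ST Mu My2.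
have TT : T^T = T by exact: transpose_inverse_sym.
have TS v : bil T v (2 *: y1 - y0) = bil S y2 v.
  by rewrite (bil_sym _ y2 v ST) /bil -My2 -!mulmxA mulKmx.
rewrite -!TS !bilE (bil_sym _ y1 y0 TT).
by field.
Qed.

Context {n : nat} {K : 'M[R]_n} {h : R} {V : 4.-tuple 'cV[R]_(n + 1) -> R^o}.
Hypothesis VL : sym_multilinear V.
Hypothesis Ksym : K^T = K.
Hypothesis Kns : K \in unitmx.
Let F (y0 y1 : 'cV[R]_(n + 1)) : R :=
  integral_num (h ^+ 2) 2^-1 (Ktilde (invmx K) 0) (Ktilde K 0)
    (formmx V y0 y1) y0 y1 / \det (Mtilde K h V 0 y0 y1).

(** The kinetic and the potential parts both change by a multiple of
    V(y0,y1,y2,y2 - y0), and these cancel. *)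
Lemma F0_conserved x0 x1 x2
    (y0 := pt x0 1) (y1 := pt x1 1) (y2 := pt x2 1) :
  Mtilde K h V 0 y0 y1 \in unitmx -> Mtilde K h V 0 y1 y2 \in unitmx ->
  x2 - 2 *: x1 + x0 =
    h ^+ 2 *: - (K *m usubmx (formmx V y0 y1 *m y2)) ->
  F y1 y2 = F y0 y1.
Proof.
move=> M01 M12 xE; set g := usubmx _ in xE; set c := h ^+ 2 in xE *.
have KT : (Ktilde K 0)^T = Ktilde K 0.
  by rewrite /Ktilde tr_block_mx Ksym !trmx0 tr_scalar_mx.
have S12 : formmx V y1 y2 *m y0 = formmx V y0 y1 *m y2.
  by rewrite (formmx_rotate VL y0).
(* The last coordinate reads 0 = 2 - 1 - 1, since all z_i are 1. *)
have yE : c *: (Ktilde K 0 *m (formmx V y0 y1 *m y2)) = 2 *: y1 - y0 - y2.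
  rewrite -[formmx _ _ _ *m _]vsubmxK -/g /Ktilde mul_block_col !mul0mx addr0.
  rewrite raddf0 mul0mx addr0 scale_col_mx scaler0.
  have -> : c *: (K *m g) = 2 *: x1 - x0 - x2.
    rewrite -[LHS]opprK -scalerN -xE.
    by apply/colP => i; rewrite !mxE; ring.
  rewrite /y0 /y1 /y2 /pt scale_col_mx !opp_col_mx !add_col_mx; congr col_mx.
  apply/matrixP => i j; rewrite !mxE.
  by case: (i == j); rewrite ?mulr1n ?mulr0n; ring.
have My2 : step_mx c (Ktilde K 0) (formmx V y0 y1) *m y2 = 2 *: y1 - y0.
  by rewrite mulmxDl mul1mx -scalemxAl -mulmxA yE addrC subrK.
have My0 : step_mx c (Ktilde K 0) (formmx V y1 y2) *m y0 = 2 *: y1 - y2.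
  by rewrite mulmxDl mul1mx -scalemxAl -mulmxA S12 yE addrC addrAC subrK.
have B12 := step_mx_bracket _ _ _ _ _ _ _ KT (formmx_sym VL _ _) M12 My0.
pose b v := bil (formmx V y0 y1) y2 v.
have B01 : _ = b y0 - 2^-1 * b y1 :=
  step_mx_bracket _ _ _ _ _ _ _ KT (formmx_sym VL _ _) M01 My2.
(* Both are V(y0,y1,y2,v). *)
have bE v : bil (formmx V y1 y2) y0 v = b v.
  rewrite /b !(bil_sym _ _ v (formmx_sym VL _ _)) /bil -!mulmxA.
  by rewrite S12.
have Kisym : (invmx K)^T = invmx K by rewrite trmx_inv Ksym.
(* A difference of squares for the symmetric form of K^-1; the recurrence then
   replaces the second difference by - c K g. *)
have kinetic : bil (invmx K) (x2 - x1) (x2 - x1)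
    - bil (invmx K) (x1 - x0) (x1 - x0) = - c * (b y2 - b y0).
  have -> : b y2 - b y0 = (g^T *m (x2 - x0)) 0 0.
    rewrite -bilNr -bilDr /b ptB subrr /bil /pt.
    rewrite -[in LHS](formmx_sym VL) -trmx_mul -[formmx _ _ _ *m _]vsubmxK.
    by rewrite tr_col_mx mul_row_col raddf0 mulmx0 addr0.
  transitivity (bil (invmx K) (x2 - 2 *: x1 + x0) (x2 - x0)).
    rewrite !bilE (bil_sym _ x2 x0 Kisym) (bil_sym _ x1 x0 Kisym).
    rewrite (bil_sym _ x2 x1 Kisym).
    by ring.
  rewrite xE bilZl bilNl mulrN mulNr /bil trmx_mul Ksym -(mulmxA _ K).
  by rewrite mulmxV // mulmx1.
have T12 := transpose_inverse_sym _ _ _ _ KT (formmx_sym VL y1 y2) M12.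
rewrite (bil_sym _ y2 y1 T12) -[y1 - y2]opprB bilNl bilNr opprK !bE in B12.

rewrite /F !integral_num_quotient // B12 B01 /y0 /y1 /y2 !ptB -/y0 -/y1 -/y2.
rewrite !bil_Ktilde !mul0r !addr0.
have -> : bil (invmx K) (x2 - x1) (x2 - x1) =
    bil (invmx K) (x1 - x0) (x1 - x0) - c * (b y2 - b y0).
  by rewrite -mulNr -kinetic [RHS]addrC subrK.
by rewrite -/c; field.
Qed.
End FirstIntegral.

End ConservedQuantity.

From mathcomp Require Import all_classical all_reals all_analysis.
Import numFieldNormedType.Exports.
Local Open Scope classical_set_scope.
Local Open Scope ring_scope.
Import ConservedQuantity.

(** * Expansion of a quotient of polynomials at zero *)
Section Quotient.
Context {R : realType}.

Lemma poly_near_neq0 (D : {poly R}) :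
  D.[0] != 0 -> \forall e \near (0 : R), D.[e] != 0.
Proof.
move=> D0; have C : D.[e] @[e --> (0 : R)] --> D.[0].
  exact: continuous_horner.
exact: (cvgr_neq0 _ C D0).
Qed.

Lemma poly_quotient_continuous (P D : {poly R}) : D.[0] != 0 ->
  P.[e] / D.[e] @[e --> (0 : R)] --> P.[0] / D.[0].
Proof.
move=> D0; apply: cvgM; first exact: continuous_horner.
by apply: cvgV => //; exact: continuous_horner.
Qed.

(** P D(0) - P(0) D vanishes at 0, hence is a multiple of e; the cofactor
    divided by D(e) D(0) is continuous, hence bounded, near 0. *)
Lemma poly_quotient_bigO (P D : {poly R}) : D.[0] != 0 ->
  (fun e : R => P.[e] / D.[e] - P.[0] / D.[0]) =O_ (0^') (fun e : R => e).
Proof.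
move=> D0; have /factor_theorem [N NE] : root (P * D.[0]%:P - P.[0]%:P * D) 0.
  by rewrite /root !hornerE subrr.
pose g (e : R) := N.[e] / (D * D.[0]%:P).[e].
have gC : g x @[x --> (0 : R)] --> g 0.
  by apply: poly_quotient_continuous; rewrite !hornerE mulf_neq0.
have D_near := poly_near_neq0 _ D0.
have g_near : \forall e \near (0 : R), `|g e| <= `|g 0| + 1.
  by apply: cvgr_norm_le gC _ _; rewrite ltrDl.
apply/eqO_exP; exists (`|g 0| + 1); first by rewrite ltr_wpDl.
apply: nbhs_dnbhs; near=> e.
have De : D.[e] != 0 by near: e.
have -> : P.[e] / D.[e] - P.[0] / D.[0] = g e * e.
  have := congr1 (horner^~ e) NE; rewrite /= !hornerE subr0 => NEe.
  by rewrite /g mulrAC -NEe !hornerE; field; apply/andP.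
by rewrite normrM ler_wpM2r //; near: e.
Unshelve. all: by end_near.
Qed.
End Quotient.

(** * The first integral *)
Theorem mainTheorem4 (R : realType) (n : nat) (hn : (1 <= n)%N)
  (h : R) (h0 : h != 0)
  (K : 'M[R]_n) (Ksym : K^T = K) (Kns : K \in unitmx)
  (W : mpoly.mpoly n R) (degW : degree_le 4 W)
  (V : 4.-tuple 'cV[R]_(n + 1) -> R^o) (symV : sym_multilinear V)
  (WV : forall y : 'cV[R]_(n + 1),
     peval (homogenize 4 W) y = 4^-1 * V [tuple y; y; y; y])
  (pol3f : 3.-tuple 'cV[R]_n -> 'cV[R]_n)
  (pol3fE : is_pol (vfield K W) pol3f) :
  exists F0 : ratfun2 R (n + 1),
    [/\ forall y0 y1 : 'cV[R]_(n + 1),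
          Mtilde K h V 0 y0 y1 \in unitmx -> rf_defined F0 y0 y1,
        forall (x0 x1 : 'cV[R]_n) (z0 z1 : R),
          let y0 := pt x0 z0 in
          let y1 := pt x1 z1 in
          Mtilde K h V 0 y0 y1 \in unitmx ->
          (fun e : R => Feps K h V e y0 y1
             - (e^-1 * (z1 - z0) ^+ 2 + rf_val F0 y0 y1))
          =O_ (0^') (fun e : R => e),
        forall x0 x1 : 'cV[R]_n,
          Mtilde K h V 0 (pt x0 1) (pt x1 1) \in unitmx ->
          Feps K h V e (pt x0 1) (pt x1 1) @[e --> 0^']
            --> rf_val F0 (pt x0 1) (pt x1 1)
      & first_integral (step h pol3f)
          (fun x0 x1 => rf_defined F0 (pt x0 1) (pt x1 1))
          (fun x0 x1 => rf_val F0 (pt x0 1) (pt x1 1))].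
Proof.
pose Ki0 := Ktilde (invmx K) 0.
exists (F0_ratfun symV (h ^+ 2) Ki0 (Ktilde K 0)).
set F0 := F0_ratfun _ _ _ _.
have F0E y0 y1 : rf_val F0 y0 y1 =
    integral_num (h ^+ 2) 2^-1 Ki0 (Ktilde K 0) (formmx V y0 y1) y0 y1
    / \det (Mtilde K h V 0 y0 y1).
  by rewrite /rf_val [peval (rf_num _) _](peval_integral_num_mpoly symV)
    [peval _ _](peval_step_det_mpoly symV).
have F0_dom y0 y1 :
    rf_defined F0 y0 y1 <-> Mtilde K h V 0 y0 y1 \in unitmx.
  by rewrite /rf_defined [peval _ _](peval_step_det_mpoly symV) unitmxE unitfE.
have expansion x0 x1 z0 z1 : let y0 := pt x0 z0 in let y1 := pt x1 z1 in
    Mtilde K h V 0 y0 y1 \in unitmx ->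
    exists P D : {poly R}, [/\ D.[0] != 0, rf_val F0 y0 y1 = P.[0] / D.[0] &
      \forall e \near (0 : R)^',
        Feps K h V e y0 y1 = e^-1 * (z1 - z0) ^+ 2 + P.[e] / D.[e]].
  move=> y0 y1 Mu; have [P [D PD]] := @Feps_fraction_poly _ _ K h V y0 y1.
  have D0 : D.[0] != 0 by rewrite (PD 0).2 -unitfE -unitmxE.
  exists P, D; split=> //; first by rewrite F0E (PD 0).1 (PD 0).2.
  near=> e; have [PE DE] := PD e.
  have e0 : e != 0 by near: e; exact: nbhs_dnbhs_neq.
  have De : D.[e] != 0 by near: e; apply: nbhs_dnbhs; exact: poly_near_neq0.
  by rewrite PE DE; apply: Feps_quotient => //; rewrite unitmxE unitfE -DE.
split.
- by move=> y0 y1 /F0_dom.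
- move=> x0 x1 z0 z1 y0 y1 /expansion[P [D [D0 F0PD FE]]].
  have /eqO_exP[k k0 bound] := poly_quotient_bigO P D D0.
  apply/eqO_exP; exists k => //; near=> e.
  have -> : Feps K h V e y0 y1 = e^-1 * (z1 - z0) ^+ 2 + P.[e] / D.[e].
    by near: e.
  by rewrite F0PD opprD addrACA subrr add0r; near: e.
- move=> x0 x1 /expansion[P [D [D0 F0PD FE]]]; rewrite F0PD.
  have PDC : P.[e] / D.[e] @[e --> (0 : R)^'] --> P.[0] / D.[0].
    apply: cvg_trans (poly_quotient_continuous P D D0).
    by apply: cvg_app; exact: nbhs_dnbhs.
  apply: cvg_trans PDC; apply: near_eq_cvg; near=> e.
  have -> : Feps K h V e (pt x0 1) (pt x1 1) =
    e^-1 * (1 - 1) ^+ 2 + P.[e] / D.[e] by near: e.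
  by rewrite subrr expr0n mulr0 add0r.
- move=> x0 x1 x2 [stepE _] /F0_dom M01 /F0_dom M12; rewrite !F0E.
  apply: F0_conserved => //; rewrite stepE.
  by rewrite (pol3_vfield symV WV _ _ _ _ pol3fE).
Unshelve. all: by end_near.
Qed.
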